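(* Let $G=(V,E)$ be a finite simple graph, let $\mathbf{v}=(v_e)_{e\in E}$ and $\mathbf{w}=(w_i)_{i\in V}$ be indeterminates, let $q$ be an indeterminate, and let $\mathbf{x}=(x_i)_{i\in V}$ be commuting indeterminates. Then, as formal power series in $\mathbf{x}$ (with all sums over $\mathbf{n}\in\mathbb{N}^V$), \[ \sum_{\mathbf{n}} Z_{G[\mathbf{n}]}(q,\mathbf{v})\,\frac{\mathbf{x}^{\mathbf{n}}}{\mathbf{n}!} =\left(\sum_{\mathbf{n}}\Bigl(\prod_{ij\in E}(1+v_{ij})^{n_in_j}\Bigr)\frac{\mathbf{x}^{\mathbf{n}}}{\mathbf{n}!}\right)^{q} \] and \[ \sum_{\mathbf{n}} Z_{G'[\mathbf{n}]}(q,\mathbf{v},\mathbf{w})\,\frac{\mathbf{x}^{\mathbf{n}}}{\mathbf{n}!} =\left(\sum_{\mathbf{n}}\Bigl(\prod_{ij\in E}(1+v_{ij})^{n_in_j}\Bigr)\Bigl(\prod_{i\in V}(1+w_i)^{n_i(n_i-1)/2}\Bigr)\frac{\mathbf{x}^{\mathbf{n}}}{\mathbf{n}!}\right)^{q}. \]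
   Context: For a finite graph $H$ with edge weights $(v_e)_{e\in E(H)}$, the multivariate Tutte polynomial is $Z_H(q,\mathbf{v})=\sum_{A\subseteq E(H)} q^{k(A)}\prod_{e\in A}v_e$, where $k(A)$ is the number of connected components of the spanning subgraph $(V(H),A)$; for the empty graph (no vertices) $Z=1$. For $\mathbf{n}\in\mathbb{N}^V$ write $\mathbf{x}^{\mathbf{n}}=\prod_i x_i^{n_i}$ and $\mathbf{n}!=\prod_i n_i!$. $G[\mathbf{n}]$ is the graph with vertex set $\{(i,\alpha): i\in V,\ \alpha\in[n_i]\}$ and an edge $\langle(i,\alpha),(j,\beta)\rangle$ of weight $v_{ij}$ for every $ij\in E$, $\alpha\in[n_i]$, $\beta\in[n_j]$ (each vertex $i$ is blown up into an independent set of size $n_i$). $G'[\mathbf{n}]$ has the same vertex set and the same edges, plus an edge $\langle(i,\alpha),(i,\beta)\rangle$ of weight $w_i$ for every $i\in V$ and $\alpha\ne\beta$ in $[n_i]$ (each vertex blown up into a clique); $Z_{G'[\mathbf{n}]}(q,\mathbf{v},\mathbf{w})$ is its multivariate Tutte polynomial with these weights. For a formal power series $F$ with constant term $1$, $F^q$ means $\exp(q\log F)$, a formal power series whose coefficients are polynomials in $q$. *)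

(* Defs.v *)
From HB Require Import structures.
From mathcomp Require Import all_boot all_order all_algebra.
Set Implicit Arguments. Unset Strict Implicit. Unset Printing Implicit Defensive.
Import Order.TTheory GRing.Theory Num.Theory.
Local Open Scope ring_scope.

Section Tutte.
Variable K : fieldType.

Definition ncomp (W : finType) (A : {set {set W}}) : nat :=
  n_comp [rel x y | [set x; y] \in A] W.

Definition tutteZ (W : finType) (Ed : {set {set W}}) (wt : {set W} -> K)
    (q : K) : K :=
  \sum_(A in powerset Ed) q ^+ ncomp A * \prod_(e in A) wt e.

Definition blowV (V : finType) (n : {ffun V -> nat}) := {i : V & 'I_(n i)}.

Definition blowE (V : finType) (E : {set {set V}}) (n : {ffun V -> nat})
    : {set {set blowV n}} :=
  [set e : {set blowV n} | [exists x : blowV n, exists y : blowV n,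
      (e == [set x; y]) && ([set tag x; tag y] \in E)]].

Definition cliqueE (V : finType) (n : {ffun V -> nat}) : {set {set blowV n}} :=
  [set e : {set blowV n} | [exists x : blowV n, exists y : blowV n,
      [&& e == [set x; y], tag x == tag y & x != y]]].

Definition blowWt (V : finType) (n : {ffun V -> nat}) (v : {set V} -> K)
    (e : {set blowV n}) : K :=
  v [set tag x | x in e].

(* weights in G'[n]: v_{ij} for edges coming from ij in E, w_i for clique
   edges <(i,a),(i,b)> *)
Definition blowWt' (V : finType) (E : {set {set V}}) (n : {ffun V -> nat})
    (v : {set V} -> K) (w : V -> K) (e : {set blowV n}) : K :=
  if [set tag x | x in e] \in E then v [set tag x | x in e]
  else oapp (fun x : blowV n => w (tag x)) 0 [pick x in e].

(* Formal power series in commuting variables (x_i)_{i in V}: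
   coefficient functions on exponent vectors n in N^V. *)
Definition series (V : finType) := {ffun V -> nat} -> K.

Definition mdeg (V : finType) (n : {ffun V -> nat}) : nat := (\sum_i n i)%N.
Definition mfact (V : finType) (n : {ffun V -> nat}) : nat := (\prod_i (n i)`!)%N.
Definition mon0 (V : finType) : {ffun V -> nat} := [ffun => 0%N].

Definition smul (V : finType) (F G : series V) : series V := fun n =>
  \sum_(m : {ffun V -> 'I_(mdeg n).+1} | [forall i, (m i <= n i)%N])
     F [ffun i => nat_of_ord (m i)] * G [ffun i => (n i - m i)%N].

Definition sone (V : finType) : series V := fun n => (n == @mon0 V)%:R.
Definition spow (V : finType) (F : series V) (k : nat) : series V :=
  iter k (smul F) (@sone V).

(* log F = sum_{k>=1} (-1)^(k+1) (F-1)^k / k ; at coefficient n only the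
   terms k <= |n| can be nonzero (F - 1 has zero constant term). *)
Definition slog (V : finType) (F : series V) : series V := fun n =>
  \sum_(1 <= k < (mdeg n).+1)
     ((-1) ^+ k.+1 / k%:R) * spow (fun m => F m - @sone V m) k n.

(* exp G = sum_{k>=0} G^k / k! for G with zero constant term. *)
Definition sexp (V : finType) (G : series V) : series V := fun n =>
  \sum_(k < (mdeg n).+1) spow G k n / (k`!)%:R.

Definition spowr (V : finType) (F : series V) (q : K) : series V :=
  sexp (fun n => q * slog F n).

End Tutte.

(* Main.v *)
(* In the Tutte polynomial at 1 + y, each connected component of the edge subset A
   chooses one of the two terms, so Z_U(1 + y) is the sum over S included in U
   of Z_S(1) Z_(U \ S)(y), where Z_S(1) is the product of the 1 + v_e over the
   edges e inside S. In a blow-up this product depends only on the number of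
   vertices of S in each fibre, and summing over subsets with prescribed fibre
   counts is the product of exponential generating functions. Hence the
   generating function of the Z at q = k is F^k. For each n both sides are
   polynomials in q, and in characteristic zero they agree at all naturals.

   That exp(k log F) is the k-th power of F follows from the Euler derivation D:
   both are solutions H of F * D H = k * D F * H with constant term 1. *)
Require Import Defs.
From HB Require Import structures.
From mathcomp Require Import all_boot all_order all_algebra.
From mathcomp Require Import boolp ring.
Set Implicit Arguments. Unset Strict Implicit. Unset Printing Implicit Defensive.
Import Order.TTheory GRing.Theory Num.Theory.
Local Open Scope ring_scope.

(** * Exponent vectors: pointwise order, truncated difference, degree *)

Section Exponents.
Variable V : finType.
Implicit Types a b n : {ffun V -> nat}.

Definition leqf a n := [forall i, (a i <= n i)%N].
Definition subf n a : {ffun V -> nat} := [ffun i => (n i - a i)%N].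
Definition addf a b : {ffun V -> nat} := [ffun i => (a i + b i)%N].

(** The index set of [smul] has a type depending on [n]. Listing it as natural-valued vectors lets
    the sums for different [n] be compared and reindexed. *)
Definition below n : seq {ffun V -> nat} :=
  [seq [ffun i => nat_of_ord (m i)]
     | m : {ffun V -> 'I_(mdeg n).+1} <- enum {ffun V -> 'I_(mdeg n).+1}
     & [forall i, (m i <= n i)%N]].

Lemma leqfP a n : reflect (forall i, a i <= n i)%N (leqf a n).
Proof. exact: forallP. Qed.

Lemma leq_mdeg n i : (n i <= mdeg n)%N.
Proof. by rewrite /mdeg (bigD1 i) //= leq_addr. Qed.

Lemma mem_below n a : (a \in below n) = leqf a n.
Proof.
apply/mapP/leqfP => [[m]|le_an].
  by rewrite mem_filter => /andP[/forallP le_mn _] -> i; rewrite ffunE.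
have lt_a i : (a i < (mdeg n).+1)%N by rewrite ltnS (leq_trans (le_an i)) ?leq_mdeg.
exists [ffun i => Ordinal (lt_a i)].
  rewrite mem_filter mem_enum andbT; apply/forallP => i; rewrite ffunE; exact: le_an.
by apply/ffunP => i; rewrite !ffunE.
Qed.

Lemma below_uniq n : uniq (below n).
Proof.
rewrite map_inj_uniq ?filter_uniq -?enumT ?enum_uniq // => m m' /ffunP eq_m.
by apply/ffunP => i; apply: val_inj; have := eq_m i; rewrite !ffunE.
Qed.

Lemma leqf_trans b a n : leqf a b -> leqf b n -> leqf a n.
Proof. by move=> /leqfP ab /leqfP bn; apply/leqfP => i; apply: leq_trans (bn i). Qed.

Lemma leqf_subf n a : leqf (subf n a) n.
Proof. by apply/leqfP => i; rewrite ffunE leq_subr. Qed.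

Lemma subfK n a : leqf a n -> subf n (subf n a) = a.
Proof. by move/leqfP=> an; apply/ffunP => i; rewrite !ffunE subKn. Qed.

Lemma addfK a b : subf (addf a b) a = b.
Proof. by apply/ffunP => i; rewrite !ffunE addKn. Qed.

Lemma subfKC a n : leqf a n -> addf a (subf n a) = n.
Proof. by move/leqfP=> an; apply/ffunP => i; rewrite !ffunE subnKC. Qed.

Lemma subfDr n a b : subf n (addf a b) = subf (subf n a) b.
Proof. by apply/ffunP => i; rewrite !ffunE subnDA. Qed.

Lemma leqf_addr a b : leqf a (addf a b).
Proof. by apply/leqfP => i; rewrite ffunE leq_addr. Qed.

Lemma leqf_addl_sub a b n : leqf a n -> leqf (addf a b) n = leqf b (subf n a).
Proof.
move/leqfP=> an; apply: eq_forallb => i; rewrite !ffunE.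
by rewrite leq_subRL // an.
Qed.

Lemma leqf_mdeg a n : leqf a n -> (mdeg a <= mdeg n)%N.
Proof. by move/leqfP=> an; apply: leq_sum. Qed.

Lemma mdeg_sub a n : leqf a n -> mdeg n = (mdeg a + mdeg (subf n a))%N.
Proof.
move/leqfP=> an; rewrite /mdeg -big_split; apply: eq_bigr => i _ /=.
by rewrite ffunE subnKC.
Qed.

Lemma mdeg_eq0 n : (mdeg n == 0%N) = (n == mon0 V).
Proof.
rewrite sum_nat_eq0; apply/forallP/eqP => [n0|-> i]; last by rewrite ffunE.
by apply/ffunP => i; rewrite ffunE; apply/eqP/n0.
Qed.

Lemma leqf0 n : leqf (mon0 V) n.
Proof. by apply/leqfP => i; rewrite ffunE. Qed.

Lemma subf0 n : subf n (mon0 V) = n.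
Proof. by apply/ffunP => i; rewrite !ffunE subn0. Qed.

Lemma mdeg0 : mdeg (mon0 V) = 0%N.
Proof. by apply/eqP; rewrite mdeg_eq0. Qed.

Lemma perm_below_sub n : perm_eq (below n) (map (subf n) (below n)).
Proof.
apply: uniq_perm; first exact: below_uniq.
  rewrite map_inj_in_uniq ?below_uniq // => a b; rewrite !mem_below => an bn.
  by move=> eq_ab; rewrite -(subfK an) eq_ab subfK.
move=> a; rewrite mem_below; apply/idP/mapP => [an|[b bn ->]]; last exact: leqf_subf.
by exists (subf n a); rewrite ?mem_below ?leqf_subf ?subfK.
Qed.

(** The substitution [a = b + c] turns pairs [b <= a <= n] into pairs [b <= n], [c <= n - b], which
    is the reindexing behind associativity of the product. *)
Lemma perm_below_add n b : leqf b n ->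
  perm_eq [seq a <- below n | leqf b a] (map (addf b) (below (subf n b))).
Proof.
move=> bn; apply: uniq_perm; first by rewrite filter_uniq ?below_uniq.
  rewrite map_inj_uniq ?below_uniq // => a c eq_ac.
  by rewrite -(addfK b a) eq_ac addfK.
move=> a; rewrite mem_filter mem_below; apply/andP/mapP => [[ba an]|[c]].
  by exists (subf a b); rewrite ?mem_below -?leqf_addl_sub // subfKC.
by rewrite mem_below -leqf_addl_sub // => ? ->; rewrite leqf_addr.
Qed.

End Exponents.

(** * The commutative ring of formal power series *)

Section SeriesRing.
Variables (K : fieldType) (V : finType).
Local Notation series := (series K V).
Implicit Types F G H : series.

Lemma smulE F G n : smul F G n = \sum_(a <- below n) F a * G (subf n a).
Proof.
rewrite big_map big_filter big_enum_cond; apply: eq_big => // m _.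
by congr (_ * G _); apply/ffunP => i; rewrite !ffunE.
Qed.

Lemma smulC : commutative (@smul K V).
Proof.
move=> F G; apply: funext => n; rewrite !smulE (perm_big _ (perm_below_sub n)) big_map.
by apply: eq_big_seq => a; rewrite mem_below => an; rewrite subfK // mulrC.
Qed.

Lemma smulA : associative (@smul K V).
Proof.
move=> F G H; apply: funext => n; rewrite !smulE.
under [RHS]eq_bigr do rewrite smulE mulr_suml.
(* The inner range [below a] is rewritten as a filter of [below n], which no longer depends on [a],
   so that the two sums can be exchanged. *)
rewrite [RHS](@eq_big_seq _ _ _ _ _ _ (fun a => \sum_(b <- below n | leqf b a)
   F b * G (subf a b) * H (subf n a))); last first.
  move=> a; rewrite mem_below => an; rewrite -[RHS]big_filter; apply: perm_big.
  apply: uniq_perm; rewrite ?filter_uniq ?below_uniq // => b.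
  by rewrite mem_filter !mem_below; case ba: (leqf b a) => //=; rewrite (leqf_trans ba).
rewrite (exchange_big_dep predT) //=; apply: eq_big_seq => b; rewrite mem_below => bn.
rewrite -[RHS]big_filter (perm_big _ (perm_below_add bn)) big_map smulE mulr_sumr.
by apply: eq_bigr => c _; rewrite addfK subfDr mulrA.
Qed.

Lemma smul1 : left_id (@sone K V) (@smul K V).
Proof.
move=> F; apply: funext => n; rewrite smulE (bigD1_seq (mon0 V)) ?below_uniq //=; last first.
  by rewrite mem_below leqf0.
rewrite /sone eqxx mul1r subf0 big1 ?addr0 // => a /negbTE ->.
by rewrite mul0r.
Qed.

Definition sadd F G : series := fun n => F n + G n.
Definition sopp F : series := fun n => - F n.
Definition szero : series := fun=> 0.

Fact saddA : associative sadd.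
Proof. by move=> F G H; apply: funext => n; apply: addrA. Qed.
Fact saddC : commutative sadd.
Proof. by move=> F G; apply: funext => n; apply: addrC. Qed.
Fact sadd0 : left_id szero sadd.
Proof. by move=> F; apply: funext => n; apply: add0r. Qed.
Fact saddN : left_inverse szero sopp sadd.
Proof. by move=> F; apply: funext => n; apply: addNr. Qed.
Fact smulDl : left_distributive (@smul K V) sadd.
Proof.
move=> F G H; apply: funext => n; rewrite /sadd !smulE -big_split.
by apply: eq_bigr => a _; rewrite mulrDl.
Qed.

(** Series are functions on an infinite type in general, so equality and choice are taken
    classically. *)
HB.instance Definition _ := gen_eqMixin series.
HB.instance Definition _ := gen_choiceMixin series.
HB.instance Definition _ := GRing.isZmodule.Build series saddA saddC sadd0 saddN.
HB.instance Definition _ :=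
  GRing.Zmodule_isComPzRing.Build series smulA smulC smul1 smulDl.

End SeriesRing.

(** * Order of vanishing, Euler derivation, exponential and logarithm *)

Section SeriesTheory.
Variables (K : fieldType) (V : finType).
Local Notation series := (series K V).
Implicit Types (F G H : series) (n : {ffun V -> nat}).

Lemma scoefD F G n : (F + G) n = F n + G n. Proof. by []. Qed.
Lemma scoefN F n : (- F) n = - F n. Proof. by []. Qed.
Lemma scoef1 n : (1 : series) n = (n == mon0 V)%:R. Proof. by []. Qed.

Lemma scoefM F G n : (F * G) n = \sum_(a <- below n) F a * G (subf n a).
Proof. exact: smulE. Qed.

Lemma scoef_sum (I : Type) (r : seq I) (P : pred I) (F : I -> series) n :
  (\sum_(i <- r | P i) F i) n = \sum_(i <- r | P i) F i n.
Proof. exact: (big_morph (fun G : series => G n)). Qed.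

Lemma scoefMn F k n : (F *+ k) n = F n *+ k.
Proof. by elim: k => // k IHk; rewrite !mulrS scoefD IHk. Qed.

Lemma scoef_sign k F n : ((-1) ^+ k * F) n = (-1) ^+ k * F n.
Proof.
by rewrite -signr_odd -[in RHS]signr_odd; case: odd; rewrite ?expr0 ?expr1 ?mul1r // !mulN1r scoefN.
Qed.

Lemma spowE F k : spow F k = F ^+ k.
Proof. by elim: k => //= k IHk; rewrite exprS -IHk. Qed.

Lemma scoefM_eq F F' G G' n :
  (forall a, leqf a n -> F a = F' a) -> (forall a, leqf a n -> G a = G' a) ->
  (F * G) n = (F' * G') n.
Proof.
move=> eqF eqG; rewrite !scoefM; apply: eq_big_seq => a; rewrite mem_below => an.
by rewrite eqF ?eqG ?leqf_subf.
Qed.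

Lemma scoefM0 F G : (F * G) (mon0 V) = F (mon0 V) * G (mon0 V).
Proof.
rewrite scoefM (bigD1_seq (mon0 V)) ?below_uniq ?mem_below ?leqf0 //= subf0.
rewrite big1_seq ?addr0 // => a /andP[na]; rewrite mem_below => /leqf_mdeg.
by rewrite mdeg0 leqn0 mdeg_eq0 (negbTE na).
Qed.

(** Order at least [k] at the origin. It replaces convergence: it shows that cutting off [sexp] and
    [slog] at the degree loses nothing. *)
Definition vanishes k F := forall n, (mdeg n < k)%N -> F n = 0.

Lemma vanishes1 F : F (mon0 V) = 0 -> vanishes 1 F.
Proof. by move=> F0 n; rewrite ltnS leqn0 mdeg_eq0 => /eqP->. Qed.

Lemma vanishesM j k F G : vanishes j F -> vanishes k G -> vanishes (j + k) (F * G).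
Proof.
move=> Fj Gk n ltn; rewrite scoefM big1_seq // => a; rewrite mem_below => /andP[_ an].
have [lt|le] := ltnP (mdeg a) j; first by rewrite Fj ?mul0r.
rewrite Gk ?mulr0 // ltnNge; apply/negP => le'; move: ltn.
by rewrite (mdeg_sub an) ltnNge leq_add.
Qed.

Lemma vanishesX k F : F (mon0 V) = 0 -> vanishes k (F ^+ k).
Proof.
by move=> F0; elim: k => // k IHk; rewrite exprS; apply: vanishesM (vanishes1 F0) IHk.
Qed.

(** The operator $\sum_i x_i \partial/\partial x_i$, diagonal on monomials. *)
Definition euler F : series := fun n => (mdeg n)%:R * F n.

Lemma eulerD F G : euler (F + G) = euler F + euler G.
Proof. by apply: funext => n; rewrite /euler !scoefD mulrDr. Qed.

Lemma eulerN F : euler (- F) = - euler F.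
Proof. by apply: funext => n; rewrite /euler !scoefN mulrN. Qed.

Lemma euler1 : euler 1 = 0.
Proof.
apply: funext => n; rewrite /euler scoef1.
by case: eqP => [->|_]; rewrite ?mdeg0 ?mul0r ?mulr0.
Qed.

Lemma euler_coef0 F : euler F (mon0 V) = 0.
Proof. by rewrite /euler mdeg0 mul0r. Qed.

(** The Leibniz rule holds because the degree of [n] is the sum of those of [a] and [subf n a]. *)
Lemma eulerM F G : euler (F * G) = euler F * G + F * euler G.
Proof.
apply: funext => n; rewrite scoefD !scoefM /euler scoefM mulr_sumr -big_split.
apply: eq_big_seq => a; rewrite mem_below => an /=.
by rewrite (mdeg_sub an) natrD mulrDl mulrA; congr (_ + _); rewrite mulrCA.
Qed.

Lemma eulerX F k : euler (F ^+ k) = F ^+ k.-1 * euler F *+ k.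
Proof.
elim: k => [|k IHk]; first by rewrite expr0 euler1 mulr0n.
rewrite exprS eulerM IHk mulrnAr mulrA [euler F * _]mulrC mulrS.
by case: k {IHk} => [|k] //=; rewrite ?mulr0n // -exprS.
Qed.

Lemma eulerMn F k : euler (F *+ k) = euler F *+ k.
Proof.
elim: k => [|k IHk]; last by rewrite !mulrS eulerD IHk.
by apply: funext => n; rewrite /euler mulr0.
Qed.

Hypothesis K0 : [pchar K] =i pred0.

Let natr_neq0 k : (k.+1%:R : K) != 0.
Proof. by rewrite ((pcharf0P K).1 K0). Qed.

(* The Euler derivation multiplies the coefficient at [n] by its degree, so in
   characteristic zero such an equation is a recursion on the degree. *)
Lemma euler_eq_unique F H H' k : F (mon0 V) = 1 ->
  F * euler H = euler F * H *+ k -> F * euler H' = euler F * H' *+ k ->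
  H (mon0 V) = H' (mon0 V) -> H = H'.
Proof.
move=> F0 eqH eqH' eq0; apply/eqP; rewrite -subr_eq0; apply/eqP.
set X := H - H'.
have eqX : F * euler X = euler F * X *+ k.
  by rewrite eulerD eulerN !mulrBr mulrnBl eqH eqH'.
have X0 : X (mon0 V) = 0 by rewrite /X scoefD scoefN eq0 subrr.
suff Xd d n : (mdeg n < d)%N -> X n = 0 by apply: funext => n; apply: Xd (ltnSn _).
elim: d n => // d IHd n; rewrite ltnS leq_eqVlt => /orP[/eqP dn|]; last exact: IHd.
have [-> //|n0] := eqVneq n (mon0 V).
have lt_sub a : a \in below n -> a != mon0 V -> (mdeg (subf n a) < d)%N.
  rewrite mem_below => an a0; rewrite -dn (mdeg_sub an) -[X in (X < _)%N]add0n ltn_add2r.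
  by rewrite lt0n mdeg_eq0.
have := congr1 (fun G : series => G n) eqX.
rewrite scoefMn !scoefM !(bigD1_seq (mon0 V)) ?below_uniq ?mem_below ?leqf0 //= subf0.
rewrite euler_coef0 mul0r F0 mul1r !big1_seq ?addr0 ?mul0rn.
- move/eqP; rewrite /euler mulf_eq0 => /orP[|/eqP //].
  by rewrite ((pcharf0P K).1 K0) mdeg_eq0 (negbTE n0).
- by move=> a /andP[a0 an]; rewrite IHd ?mulr0 // lt_sub.
- by move=> a /andP[a0 an]; rewrite /euler IHd ?mulr0 // lt_sub.
Qed.

Lemma sexp_coef0 G : sexp G (mon0 V) = 1.
Proof. by rewrite /sexp mdeg0 big_ord1 /spow /= /sone eqxx divr1. Qed.

(** [G ^+ k] has order at least [k], so the extra terms are zero. A free bound [N] allows one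
    cut-off for several exponent vectors. *)
Lemma sexp_trunc G n N : G (mon0 V) = 0 -> (mdeg n < N)%N ->
  sexp G n = \sum_(k < N) (G ^+ k) n / k`!%:R.
Proof.
move=> G0 ltN; rewrite /sexp -(big_mkord predT (fun k => spow G k n / k`!%:R)).
rewrite -(big_mkord predT (fun k => (G ^+ k) n / k`!%:R)) (big_cat_nat (leq0n _) ltN) //=.
rewrite [X in _ = _ + X]big_nat_cond [X in _ = _ + X]big1 ?addr0; last first.
  by move=> k; rewrite andbT => /andP[le _]; rewrite vanishesX ?mul0r.
by apply: eq_bigr => k _; rewrite spowE.
Qed.

(** Termwise differentiation: $D(G^{k+1}/(k+1)!) = DG \cdot G^k/k!$. *)
Lemma euler_sexp G : G (mon0 V) = 0 -> euler (sexp G) = euler G * sexp G.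
Proof.
move=> G0; apply: funext => n; rewrite {1}/euler (sexp_trunc G0 (ltnSn _)) mulr_sumr.
rewrite (eq_bigr (fun k : 'I_(mdeg n).+1 => (euler (G ^+ k)) n / k`!%:R)); last first.
  by move=> k _; rewrite /euler mulrA.
rewrite big_ord_recl /= expr0 euler1 mul0r add0r.
transitivity (\sum_(k < mdeg n) (euler G * G ^+ k) n / k`!%:R).
  apply: eq_bigr => k _; rewrite eulerX scoefMn [bump _ _]add1n /= factS natrM invfM.
  by rewrite [G ^+ _ * _]mulrC -(mulr_natr ((euler G * G ^+ k) n)) mulrA mulfK ?natr_neq0.
under eq_bigr do rewrite scoefM mulr_suml.
rewrite exchange_big scoefM /=; apply: eq_big_seq => a; rewrite mem_below => an.
(* Differentiation has lowered the cut-off to [k < mdeg n]. This still suffices: [euler G] vanishes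
   at [a = 0], and otherwise [subf n a] has degree below that of [n]. *)
have [->|a0] := eqVneq a (mon0 V).
  by rewrite euler_coef0 mul0r big1 // => k _; rewrite !mul0r.
rewrite (@sexp_trunc G _ (mdeg n)) //; last first.
  by rewrite (mdeg_sub an) -[X in (X < _)%N]add0n ltn_add2r lt0n mdeg_eq0.
by rewrite mulr_sumr; apply: eq_bigr => k _; rewrite mulrA.
Qed.

Lemma slog_coef0 F : slog F (mon0 V) = 0.
Proof. by rewrite /slog mdeg0 big_geq. Qed.

(** With $U = F - 1$, differentiating the logarithm term by term leaves the geometric series of
    $1/(1+U)$ times $DF$. *)
Lemma euler_slog_trunc F n N : F (mon0 V) = 1 -> (mdeg n <= N)%N ->
  euler (slog F) n = (\sum_(k < N) (- (F - 1)) ^+ k * euler F) n.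
Proof.
move=> F0 leN; set U := F - 1; have U0 : U (mon0 V) = 0.
  rewrite /U.
  by rewrite scoefD scoefN scoef1 F0 eqxx subrr.
have DU : euler U = euler F by rewrite eulerD eulerN euler1 subr0.
rewrite scoef_sum -(big_mkord predT (fun k => ((- U) ^+ k * euler F) n)).
rewrite (big_cat_nat (leq0n _) leN) //= [X in _ = _ + X]big_nat_cond [X in _ = _ + X]big1 ?addr0.
  rewrite -[LHS]/((mdeg n)%:R * slog F n) /slog big_add1 mulr_sumr; apply: eq_bigr => k _.
  have -> : (fun m => F m - @sone K V m) = U by [].
  rewrite spowE mulrCA.
  have -> : (mdeg n)%:R * (U ^+ k.+1) n = (U ^+ k * euler F) n * k.+1%:R.
    by rewrite -[LHS]/(euler (U ^+ k.+1) n) eulerX DU scoefMn mulr_natr.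
  rewrite mulrA mulrAC mulfVK ?natr_neq0 // [(- U) ^+ _]exprNn -mulrA scoef_sign !exprS.
  by rewrite !mulN1r opprK.
move=> k /andP[/andP[le _] _]; rewrite (@vanishesM k 1) //.
- by apply: vanishesX; rewrite scoefN U0 oppr0.
- exact/vanishes1/euler_coef0.
- by rewrite addn1 ltnS.
Qed.

Lemma euler_slog F : F (mon0 V) = 1 -> F * euler (slog F) = euler F.
Proof.
move=> F0; apply: funext => n; set U := F - 1.
rewrite (@scoefM_eq F F _ (\sum_(k < mdeg n) (- U) ^+ k * euler F)) //; last first.
  by move=> a an; apply: euler_slog_trunc (leqf_mdeg an).
(* With $F = 1 - (-U)$ the geometric sum telescopes to $1 - (-U)^N$ for $N$ the degree of [n]. The
   remainder $(-U)^N DF$ has order above $N$, since $DF$ has no constant term. *)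
have {1}-> : F = - (- U - 1) by rewrite opprD !opprK subrK.
rewrite -mulr_suml mulrA mulNr -subrX1 opprB mulrBl mul1r scoefD scoefN.
rewrite (@vanishesM (mdeg n) 1) ?oppr0 ?addr0 ?addn1 //.
  by apply: vanishesX; rewrite /U scoefN scoefD scoefN scoef1 F0 eqxx subrr oppr0.
exact/vanishes1/euler_coef0.
Qed.

Lemma spowr_nat F k : F (mon0 V) = 1 -> spowr F k%:R = F ^+ k.
Proof.
move=> F0; rewrite /spowr.
have -> : (fun n => k%:R * slog F n) = slog F *+ k.
  by apply: funext => n; rewrite scoefMn mulr_natl.
have L0 : (slog F *+ k) (mon0 V) = 0 by rewrite scoefMn slog_coef0 mul0rn.
apply: (@euler_eq_unique F _ _ k) => //.
- by rewrite euler_sexp // eulerMn mulrA mulrnAr euler_slog // mulrnAl.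
- by case: k {L0} => [|k]; rewrite eulerX ?mulr0n ?mulr0 //= mulrnAr mulrA -exprS mulrC.
- rewrite sexp_coef0; elim: k {L0} => [|k IHk]; first by rewrite expr0 scoef1 eqxx.
  by rewrite exprS scoefM0 F0 mul1r.
Qed.

End SeriesTheory.

(** * Expansion of products and powers over subsets *)

Section SubsetSums.
Variables (R : comNzRingType) (I : finType).
Implicit Types (A B C J : {set I}) (F G : I -> R).

Lemma prodrD_subset A F G :
  \prod_(i in A) (F i + G i) =
  \sum_(J : {set I} | J \subset A) \prod_(i in J) F i * \prod_(i in A :\: J) G i.
Proof.
(* Outside [A] the factor 1 is split as 0 + 1, so a set [J] not contained in [A] contributes 0 to
   the expansion over all subsets. *)
rewrite big_mkcond (eq_bigr (fun i => (if i \in A then F i else 0) +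
   (if i \in A then G i else 1))) => [|i _]; last by case: ifP; rewrite ?add0r.
rewrite bigA_distr [RHS]big_mkcond; apply: eq_bigr => J _.
case: ifPn => [JA|/subsetPn[i iJ niA]]; last first.
  by rewrite (bigD1 i) //= iJ (negbTE niA) mul0r.
rewrite [X in _ = X * _]big_mkcond [X in _ = _ * X]big_mkcond -big_split.
apply: eq_bigr => i _ /=; rewrite inE; case: ifPn => [/(subsetP JA)->|_] /=.
  by rewrite mulr1.
by rewrite mul1r.
Qed.

Lemma sum_subset_prod A F :
  \sum_(J : {set I} | J \subset A) \prod_(i in J) F i = \prod_(i in A) (1 + F i).
Proof.
under [RHS]eq_bigr do rewrite addrC.
by rewrite prodrD_subset; apply: eq_bigr => J _; rewrite big1_eq mulr1.
Qed.

Lemma sum_subset_expr A (y : R) :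
  \sum_(J : {set I} | J \subset A) y ^+ #|A :\: J| = (1 + y) ^+ #|A|.
Proof.
rewrite -[RHS]prodr_const prodrD_subset; apply: eq_bigr => J _.
by rewrite big1_eq mul1r prodr_const.
Qed.

Lemma sum_subsetU B C (g : {set I} -> R) : [disjoint B & C] ->
  \sum_(A : {set I} | A \subset B :|: C) g A =
  \sum_(J : {set I} | J \subset B) \sum_(L : {set I} | L \subset C) g (J :|: L).
Proof.
move=> dBC; rewrite pair_big_dep /=.
rewrite (reindex_onto (fun p : {set I} * {set I} => p.1 :|: p.2)
                      (fun A => (A :&: B, A :&: C))) /=; last first.
  by move=> A AU; rewrite -setIUr; apply/setIidPl.
apply: eq_bigl => -[J L] /=; rewrite subUset xpair_eqE !setIUl.
apply/andP/andP => [[_ /andP[/eqP <- /eqP <-]]|[JB LC]].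
  by rewrite !subUset !subsetIr.
have dJC : J :&: C = set0 by apply/disjoint_setI0/(disjointWl JB).
have dLB : L :&: B = set0.
  by apply/disjoint_setI0/(disjointWl LC); rewrite disjoint_sym.
rewrite dJC dLB setU0 set0U (setIidPl JB) (setIidPl LC) !eqxx.
by rewrite (subset_trans JB) ?subsetUl // (subset_trans LC) ?subsetUr.
Qed.

End SubsetSums.

(** * Tutte polynomials of induced subgraphs and the recursion from [y] to [1 + y] *)

Section InducedTutte.
Variables (K : fieldType) (W : finType) (Ed : {set {set W}}) (wt : {set W} -> K).
Hypothesis Ed2 : forall e, e \in Ed -> exists x y, e = [set x; y].
Implicit Types (A : {set {set W}}) (S U : {set W}) (q y : K).

Definition adj A : rel W := [rel x y | [set x; y] \in A].
Definition inducedE U : {set {set W}} := [set e in Ed | e \subset U].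

(** The ambient type stays [W] and components are counted by their roots in [U], so that induced
    subgraphs on different [U] need no change of vertex type. *)
Definition inducedZ U q : K :=
  \sum_(A : {set {set W}} | A \subset inducedE U) q ^+ n_comp (adj A) U * \prod_(e in A) wt e.

Lemma adj_sym A : connect_sym (adj A).
Proof. by apply: sym_connect_sym => x y; rewrite /adj /= setUC. Qed.

(** Both conditions say that no edge of [A] joins [S] to its complement in [U]; such [S] are unions
    of components. *)
Lemma closed_adjP A S U : S \subset U -> A \subset inducedE U ->
  reflect (closed (adj A) S) (A \subset inducedE S :|: inducedE (U :\: S)).
Proof.
move=> SU /subsetP AU; apply: (iffP subsetP) => [AS x y /AS|clS e eA].
  rewrite !inE !subUset !sub1set !inE => /orP[/andP[_ /andP[-> ->]]//|].
  by case/andP=> _ /andP[/andP[/negbTE-> _] /andP[/negbTE-> _]].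
have := AU e eA; rewrite !inE => /andP[eEd]; rewrite eEd.
have [x [y eq_e]] := Ed2 eEd; rewrite eq_e in eA *.
have := clS x y eA; rewrite !subUset !sub1set !inE => <- /andP[-> ->].
by rewrite !andbT; case: (x \in S).
Qed.

Lemma inducedE_disjoint S S' : [disjoint S & S'] -> [disjoint inducedE S & inducedE S'].
Proof.
move=> dS; apply/pred0P => e /=; rewrite !inE; apply/negbTE/negP.
case/andP=> /andP[/Ed2[x [y ->]]]; rewrite !subUset !sub1set.
by case/andP=> xS _ /andP[_ /andP[xS' _]]; rewrite (disjointFr dS xS) in xS'.
Qed.

Lemma closed_induced A U : A \subset inducedE U -> closed (adj A) U.
Proof.
move=> /subsetP AU x y /AU.
by rewrite inE subUset !sub1set => /andP[_ /andP[-> ->]].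
Qed.

(** A path starting in [S'] cannot use an edge of [A1], so connectivity from its points, and with it
    the choice of roots, depends on [A2] only. *)
Lemma n_comp_induced A1 A2 S S' : [disjoint S & S'] ->
  A1 \subset inducedE S -> A2 \subset inducedE S' ->
  n_comp (adj (A1 :|: A2)) S' = n_comp (adj A2) S'.
Proof.
move=> dS A1S A2S; apply: eq_card => x; rewrite !inE.
case xS: (x \in S'); rewrite ?andbF // !andbT /roots /fingraph.root; congr (odflt _ _ == _).
apply: eq_pick => y; apply/idP/idP; last first.
  by apply: connect_sub => a b ab; apply: connect1; rewrite /adj /= inE [_ \in A2]ab orbT.
case/connectP=> p; elim: p x xS => [|z p IHp] x xS /=; first by move=> _ ->.
case/andP; rewrite {1}/adj /= inE => /orP[xz|xz] zp ylast.
  have := subsetP A1S _ xz; rewrite inE subUset !sub1set => /andP[_ /andP[]].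
  by move/(disjointFr dS); rewrite xS.
have zS : z \in S' by rewrite -(closed_induced A2S xz).
by apply: connect_trans (connect1 _) (IHp z zS zp ylast).
Qed.

Lemma n_compE A U : n_comp (adj A) U = #|[set x in U | roots (adj A) x]|.
Proof. by apply: eq_card => x; rewrite !inE andbC. Qed.

(** Each component of [A] in [U] goes either into [S], with weight 1, or outside, with weight [y];
    this is the binomial expansion over sets of roots. *)
Lemma sum_closed A U y : A \subset inducedE U ->
  \sum_(S : {set W} | (S \subset U) && (A \subset inducedE S :|: inducedE (U :\: S)))
     y ^+ n_comp (adj A) (U :\: S) = (1 + y) ^+ n_comp (adj A) U.
Proof.
move=> AU; have clU := closed_induced AU.
set r := fingraph.root (adj A); set R := [set x in U | roots (adj A) x].
rewrite n_compE -/R -sum_subset_expr.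
have rR x : x \in U -> r x \in R.
  move=> xU; rewrite inE (roots_root (adj_sym A)) andbT.
  by rewrite -(closed_connect clU (connect_root _ x)).
(* The bijection: [S] gives the set of roots it contains, and [J] gives the union of the components
   whose root is in [J]. *)
rewrite [RHS](reindex_onto (fun S => S :&: R) (fun J => [set x in U | r x \in J])) /=.
  apply: eq_big => [S|S /andP[SU _]]; last first.
    rewrite n_compE; congr (_ ^+ _); apply: eq_card => x; rewrite !inE.
    by case: (x \in U); case: (x \in S); case: (roots _ _).
  rewrite subsetIr; apply/andP/eqP => [[SU /(closed_adjP SU AU) clS]|<-].
    apply/setP => x; rewrite !inE -(closed_connect clS (connect_root _ x)).
    apply/idP/idP => [/andP[_ /andP[]]//|xS].
    have xU := subsetP SU x xS; rewrite xU xS /=.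
    by have := rR x xU; rewrite inE.
  have SU : [set x in U | r x \in S :&: R] \subset U.
    by apply/subsetP => x; rewrite inE => /andP[].
  split=> //; apply/(closed_adjP SU AU) => x z xz; rewrite !inE (clU x z xz).
  by rewrite /r (fingraph.rootP (adj_sym A) (connect1 xz)).
move=> J JR; apply/setP => x; rewrite !inE; apply/andP/idP => [[/andP[_ +] /andP[_ /eqP]]|xJ].
  by move=> rJ rx; rewrite /r rx in rJ.
have := subsetP JR x xJ; rewrite inE => /andP[xU rx]; rewrite xU rx.
by split=> //; rewrite /r (eqP rx).
Qed.

Lemma prod_inducedZ S U y : S \subset U ->
  \prod_(e in inducedE S) (1 + wt e) * inducedZ (U :\: S) y =
  \sum_(A : {set {set W}} | A \subset inducedE S :|: inducedE (U :\: S))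
     y ^+ n_comp (adj A) (U :\: S) * \prod_(e in A) wt e.
Proof.
move=> SU; have dS : [disjoint S & U :\: S].
  by rewrite -setI_eq0 setIDA setIC -setIDA setDv setI0.
have dE := inducedE_disjoint dS.
rewrite sum_subsetU // -sum_subset_prod mulr_suml; apply: eq_bigr => A1 A1S.
rewrite /inducedZ mulr_sumr; apply: eq_bigr => A2 A2S.
rewrite mulrCA (n_comp_induced dS A1S A2S); congr (_ * _).
rewrite -bigU /=; last by rewrite (disjointWl A1S) // (disjointWr A2S).
by apply: eq_bigl => e; rewrite !inE.
Qed.

(** After the products are expanded, the sums over [S] and [A] are exchanged; for fixed [A] the
    inner sum is that of [sum_closed]. *)
Lemma inducedZ_add1 U y :
  inducedZ U (1 + y) =
  \sum_(S : {set W} | S \subset U) \prod_(e in inducedE S) (1 + wt e) * inducedZ (U :\: S) y.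
Proof.
rewrite [RHS](eq_bigr _ (fun S SU => prod_inducedZ y SU)).
rewrite (exchange_big_dep (fun A : {set {set W}} => A \subset inducedE U)) /=; last first.
  move=> S A SU /subset_trans; apply; rewrite subUset.
  by apply/andP; split; apply/subsetP => e; rewrite !inE => /andP[->] /subset_trans ->;
    rewrite ?subsetDl.
by apply: eq_bigr => A AU; rewrite -mulr_suml sum_closed.
Qed.

(** A nonempty [U] has at least one component, so every term has a positive power of 0. For empty
    [U] the one term is [0 ^+ 0 = 1]. *)
Lemma inducedZ_0 U : inducedZ U 0 = (U == set0)%:R.
Proof.
have [->|/set0Pn[x xU]] := eqVneq U set0.
  rewrite /inducedZ (bigD1 set0) ?sub0set //= big_set0 mulr1 big1 ?addr0.
    by rewrite (_ : n_comp _ _ = 0%N) ?expr0 //; apply: eq_card0 => x; rewrite !inE andbF.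
  move=> A /andP[A0 /set0Pn[e eA]]; have := subsetP A0 e eA; rewrite inE => /andP[/Ed2[x [y ->]]].
  by rewrite subUset !sub1set !inE.
rewrite /inducedZ big1 // => A AU.
suff: n_comp (adj A) U != 0%N by rewrite expr0n => /negbTE->; rewrite mul0r.
rewrite -lt0n; apply/card_gt0P; exists (fingraph.root (adj A) x).
by rewrite !inE (roots_root (adj_sym A)) /= -(closed_connect (closed_induced AU) (connect_root _ x)).
Qed.

End InducedTutte.

(** * Counting subsets with prescribed fibre sizes *)

Section FibreCount.
Variables (V W : finType) (t : W -> V).
Implicit Types (S U : {set W}) (a n : {ffun V -> nat}).

Definition fibre S i := [set x in S | t x == i].
Definition cnt S : {ffun V -> nat} := [ffun i => #|fibre S i|].

Lemma fibreS S U i : S \subset U -> fibre S i \subset fibre U i.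
Proof.
by move=> /subsetP SU; apply/subsetP => x; rewrite !inE => /andP[/SU-> ->].
Qed.

Lemma leqf_cnt S U : S \subset U -> leqf (cnt S) (cnt U).
Proof. by move=> SU; apply/leqfP => i; rewrite !ffunE subset_leq_card ?fibreS. Qed.

Lemma cntD S U : S \subset U -> cnt (U :\: S) = subf (cnt U) (cnt S).
Proof.
move=> SU; apply/ffunP => i; rewrite !ffunE.
rewrite (_ : fibre (U :\: S) i = fibre U i :\: fibre S i).
  by rewrite cardsD (setIidPr (fibreS i SU)).
by apply/setP => x; rewrite !inE; case: (x \in S); case: (x \in U); case: (t x == i).
Qed.

Lemma cnt_eq0 U : (cnt U == mon0 V) = (U == set0).
Proof.
apply/eqP/eqP => [/ffunP U0|->]; last first.
  by apply/ffunP => i; rewrite !ffunE; apply: eq_card0 => x; rewrite !inE.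
apply/setP => x; rewrite inE; apply/negP => xU.
have := U0 (t x); rewrite !ffunE => /eqP; rewrite cards_eq0 => /eqP/setP/(_ x).
by rewrite !inE xU eqxx.
Qed.

(** A subset is determined by its fibres, and these can be chosen independently. *)
Lemma card_cnt U a :
  #|[set S : {set W} | S \subset U & cnt S == a]| = (\prod_i 'C(cnt U i, a i))%N.
Proof.
pose D i := [pred B : {set W} | (B \subset fibre U i) && (#|B| == a i)].
pose f S : {ffun V -> {set W}} := [ffun i => fibre S i].
have f_inj : injective f.
  move=> S S' /ffunP eqS; apply/setP => x.
  by have /setP/(_ x) := eqS (t x); rewrite !ffunE !inE eqxx !andbT.
rewrite -(card_imset _ f_inj) (_ : f @: _ = [set g in family D]); last first.
  apply/setP => g; rewrite inE; apply/imsetP/familyP => [[S]|gD].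
    rewrite inE => /andP[SU /eqP aS] -> i.
    by rewrite ffunE inE /= fibreS //= -aS ffunE.
  have gi i x : x \in g i -> x \in U /\ t x = i.
    by have /andP[/subsetP gU _] := gD i; move/gU; rewrite inE => /andP[-> /eqP].
  have fg i : fibre (\bigcup_j g j) i = g i.
    apply/setP => x; rewrite inE; apply/andP/idP => [[/bigcupP[j _ xj] /eqP <-]|xi].
      by have [_ ->] := gi j x xj.
    by split; [apply/bigcupP; exists i|have [_ ->] := gi i x xi].
  exists (\bigcup_i g i); last by apply/ffunP => i; rewrite ffunE fg.
  rewrite inE; apply/andP; split.
    by apply/bigcupsP => i _; apply/subsetP => x /gi[].
  apply/eqP/ffunP => i; rewrite ffunE fg.
  by have /andP[_ /eqP] := gD i.
rewrite cardsE card_family foldrE big_map big_enum /=; apply: eq_bigr => i _.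
by rewrite ffunE -cards_draws cardsE.
Qed.

Lemma mfact_bin n a : leqf a n ->
  (\prod_i 'C(n i, a i) * (mfact a * mfact (subf n a)) = mfact n)%N.
Proof.
move=> /leqfP an; rewrite /mfact -!big_split; apply: eq_bigr => i _ /=.
by rewrite ffunE bin_fact.
Qed.

End FibreCount.

Lemma mfact0 (V : finType) : mfact (mon0 V) = 1%N.
Proof. by rewrite /mfact big1 // => i _; rewrite ffunE. Qed.

Lemma mfact_gt0 (V : finType) (n : {ffun V -> nat}) : (0 < mfact n)%N.
Proof. by apply: prodn_gt0 => i; rewrite fact_gt0. Qed.

Lemma poly_nat_eq (K : fieldType) (K0 : [pchar K] =i pred0) (P Q : {poly K}) :
  (forall k, P.[k%:R] = Q.[k%:R]) -> P = Q.
Proof.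
move=> PQ; apply/eqP; rewrite -subr_eq0; apply: contraT => nz.
(* The first [size (P - Q)] naturals are distinct roots, one more than the degree allows. *)
have := @max_poly_roots _ _ [seq k%:R | k <- iota 0 (size (P - Q))] nz.
rewrite size_map size_iota ltnn; apply.
  by apply/allP => _ /mapP[k _ ->]; rewrite /root hornerD hornerN PQ subrr.
rewrite map_inj_in_uniq ?iota_uniq // => i j _ _.
wlog le_ij : i j / (i <= j)%N.
  by move=> IH eq_ij; case/orP: (leq_total i j) => le; [|symmetry]; apply: IH.
move=> /esym/eqP; rewrite -subr_eq0 -natrB // ((pcharf0P K).1 K0) subn_eq0 => le_ji.
by apply/eqP; rewrite eqn_leq le_ij.
Qed.

(** * Generating functions and passage from natural [q] to arbitrary [q] *)

Section ExponentialFormula.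
Variables (K : fieldType) (V : finType).
Hypothesis K0 : [pchar K] =i pred0.
Implicit Types (a b : {ffun V -> nat} -> K) (n : {ffun V -> nat}).

Definition egf a : series K V := fun n => a n / (mfact n)%:R.

Let mfact_neq0 n : ((mfact n)%:R : K) != 0.
Proof. by rewrite ((pcharf0P K).1 K0) -lt0n mfact_gt0. Qed.

(** The number of [S] with counts [m] is a product of binomials, and these are exactly the
    coefficients $n!/(m!(n-m)!)$ in a product of exponential generating functions. *)
Lemma egfM (W : finType) (t : W -> V) a b (U : {set W}) :
  \sum_(S : {set W} | S \subset U) a (cnt t S) * b (cnt t (U :\: S)) =
  (mfact (cnt t U))%:R * (egf a * egf b) (cnt t U).
Proof.
set n := cnt t U; pose h m := a m * b (subf n m).
(* A sum over the single value [m = cnt t S] is inserted, so that exchanging sums groups the [S] by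
   their counts. *)
transitivity (\sum_(S : {set W} | S \subset U) \sum_(m <- below n | m == cnt t S) h m).
  apply: eq_bigr => S SU; rewrite cntD // -big_filter.
  rewrite filter_pred1_uniq ?below_uniq ?mem_below ?leqf_cnt //.
  by rewrite big_seq1.
rewrite (exchange_big_dep predT) //= scoefM mulr_sumr.
apply: eq_big_seq => m; rewrite mem_below => mn.
rewrite (eq_bigl (mem [set S : {set W} | S \subset U & cnt t S == m])); last first.
  by move=> S /=; rewrite inE; congr (_ && _); apply: eq_sym.
rewrite sumr_const card_cnt -/n /egf -(mfact_bin mn) 2!natrM /h.
rewrite -[LHS]mulr_natr; field; by rewrite !mfact_neq0.
Qed.

Lemma spow_scale (q : K) (G : series K V) k n :
  spow (fun m => q * G m) k n = q ^+ k * spow G k n.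
Proof.
elim: k n => [|k IHk] n /=; first by rewrite mul1r.
rewrite !smulE mulr_sumr; apply: eq_bigr => m _.
by rewrite IHk exprS mulrACA.
Qed.

Variables (W : finType) (t : W -> V) (Ed : {set {set W}}) (wt : {set W} -> K).
Hypothesis Ed2 : forall e, e \in Ed -> exists x y, e = [set x; y].
Variable a : {ffun V -> nat} -> K.
(** The only property of the weights that is specific to blow-ups; stated abstractly, it serves both
    graphs at once. *)
Hypothesis prod_wt : forall S, \prod_(e in inducedE Ed S) (1 + wt e) = a (cnt t S).

(** Induction on [k] for all [U] together, since the recursion passes to [U :\: S]. *)
Lemma inducedZ_nat k (U : {set W}) :
  inducedZ Ed wt U k%:R = (mfact (cnt t U))%:R * (egf a ^+ k) (cnt t U).
Proof.
elim: k U => [|k IHk] U.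
  rewrite inducedZ_0 // expr0 scoef1 cnt_eq0.
  have [->|] := eqVneq U set0; last by rewrite mulr0.
  by have /eqP-> : cnt t set0 == mon0 V; rewrite ?cnt_eq0 // mfact0 mulr1.
rewrite -natr1 addrC inducedZ_add1 //.
pose b n := (mfact n)%:R * (egf a ^+ k) n.
transitivity (\sum_(S : {set W} | S \subset U) a (cnt t S) * b (cnt t (U :\: S))).
  by apply: eq_bigr => S _; rewrite prod_wt IHk.
rewrite egfM exprS (_ : egf b = egf a ^+ k) //.
by apply: funext => n; rewrite /egf /b mulrAC mulfV ?mul1r.
Qed.

(** This is [prod_wt] at the empty set, where the product has no factors. *)
Lemma egf_coef0 : egf a (mon0 V) = 1.
Proof.
have <- : cnt t set0 = mon0 V by apply/eqP; rewrite cnt_eq0.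
rewrite /egf -prod_wt big1 => [|e]; last first.
  rewrite inE => /andP[/Ed2[x [y ->]]].
  by rewrite subUset !sub1set inE.
have -> : cnt t set0 = mon0 V by apply/eqP; rewrite cnt_eq0.
by rewrite mfact0 divr1.
Qed.

Lemma tutteZ_egf q : tutteZ Ed wt q / (mfact (cnt t setT))%:R = spowr (egf a) q (cnt t setT).
Proof.
set n := cnt t setT.
pose P : {poly K} := \sum_(A : {set {set W}} | A \subset inducedE Ed setT)
  (\prod_(e in A) wt e) *: 'X^(n_comp (adj A) [set: W]).
(* At fixed [n] the exponential is a finite sum, and [spow_scale] extracts $q^k$ from its [k]-th
   term; hence it is a polynomial in $q$. *)
pose Q : {poly K} := \sum_(k < (mdeg n).+1) (spow (slog (egf a)) k n / k`!%:R) *: 'X^k.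
have PE y : P.[y] = inducedZ Ed wt setT y.
  by rewrite horner_sum; apply: eq_bigr => A _; rewrite hornerZ hornerXn mulrC.
have QE y : Q.[y] = spowr (egf a) y n.
  rewrite horner_sum; apply: eq_bigr => k _.
  by rewrite hornerZ hornerXn spow_scale mulrC mulrA.
have -> : tutteZ Ed wt q = inducedZ Ed wt setT q.
  apply: eq_big => [A|A _].
    rewrite powersetE (_ : inducedE Ed setT = Ed) //; apply/setP => e.
    by rewrite inE subsetT andbT.
  congr (_ ^+ _ * _); rewrite /ncomp.
  by apply: eq_card => x; rewrite !inE.
rewrite -PE -QE; have -> : P = (mfact n)%:R *: Q; last first.
  by rewrite hornerZ mulrC mulKf.
apply: (poly_nat_eq K0) => k; rewrite PE hornerZ QE inducedZ_nat.
by rewrite (spowr_nat K0) // egf_coef0.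
Qed.

End ExponentialFormula.

(** * Edge products in the two blow-ups *)

Section BlowUp.
Variables (K : fieldType) (V : finType) (E : {set {set V}}).
Hypothesis HE : forall e, e \in E -> #|e| = 2%N.
Variable n : {ffun V -> nat}.
Implicit Types (S : {set blowV n}) (x y : blowV n) (e : {set blowV n}) (i j : V).

Let t : blowV n -> V := fun x => tag x.

Lemma cnt_setT : cnt t setT = n.
Proof.
pose T i := 'I_(n i).
have tag_inj i : injective (Tagged T : T i -> blowV n).
  by move=> u u' /eqP; rewrite eq_Tagged => /eqP.
apply/ffunP => i; rewrite ffunE -[RHS]card_ord -(card_imset _ (tag_inj i)).
apply: eq_card => x; rewrite !inE; apply/eqP/imsetP => [<-|[u _ ->] //].
by exists (tagged x); case: x.
Qed.

Lemma blowEP e :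
  reflect (exists x y, e = [set x; y] /\ [set t x; t y] \in E) (e \in blowE E n).
Proof.
rewrite inE; apply: (iffP existsP) => [[x /existsP[y /andP[/eqP -> xyE]]]|].
  by exists x, y.
by case=> x [y [-> xyE]]; exists x; apply/existsP; exists y; rewrite eqxx.
Qed.

Lemma cliqueEP e :
  reflect (exists x y, [/\ e = [set x; y], t x = t y & x != y]) (e \in cliqueE n).
Proof.
rewrite inE; apply: (iffP existsP) => [[x /existsP[y /and3P[/eqP -> /eqP xy nxy]]]|].
  by exists x, y.
by case=> x [y [-> xy nxy]]; exists x; apply/existsP; exists y; apply/and3P; split=> //; apply/eqP.
Qed.

Lemma imset_t x y : [set tag z | z in [set x; y]] = [set t x; t y].
Proof. by rewrite imsetU1 imset_set1. Qed.

(** For $d = \{i,j\}$ these edges correspond to pairs in the product of the two fibres; $i \ne j$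
    orders the end points and makes the map injective. *)
Lemma card_edges_over S d : d \in E ->
  #|[set e in inducedE (blowE E n) S | [set tag z | z in e] == d]| =
  (\prod_(i in d) cnt t S i)%N.
Proof.
move=> dE; have /eqP/cards2P[i [j [nij eq_d]]] := HE dE.
pose f (p : blowV n * blowV n) := [set p.1; p.2].
have f_inj : {in setX (fibre t S i) (fibre t S j) &, injective f}.
  case=> x y [x' y']; rewrite !inE /= => /andP[/andP[_ /eqP xi] /andP[_ /eqP yj]].
  case/andP=> [/andP[_ /eqP xi'] /andP[_ /eqP yj']] eqf.
  have /set2P[->|xy'] : x \in [set x'; y'] by rewrite -[[set _; _]]eqf set21.
    have /set2P[yx'|-> //] : y \in [set x'; y'] by rewrite -[[set _; _]]eqf set22.
    by rewrite -yj yx' xi' eqxx in nij.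
  by rewrite -xi xy' yj' eqxx in nij.
rewrite eq_d big_setU1 ?inE // big_set1 !ffunE /= -cardsX -(card_in_imset f_inj).
apply: eq_card => e; rewrite inE [e \in inducedE _ _]inE; apply/idP/imsetP => [|[[x y] + ->]].
  case/andP=> /andP[/blowEP[x [y [-> _]]]]; rewrite imset_t subUset !sub1set.
  case/andP=> xS yS /eqP eq_t.
  (* The projection has two elements, so the end points lie over different vertices; up to a swap
     they lie over [i] and [j]. *)
  have /set2P[xi|xj] : t x \in [set i; j] by rewrite -eq_t set21.
    have /set2P[yi|yj] : t y \in [set i; j] by rewrite -eq_t set22.
      by have := cards2 i j; rewrite -eq_t xi yi setUid cards1 nij.
    by exists (x, y); rewrite ?inE /= ?xS ?yS ?xi ?yj ?eqxx.
  have /set2P[yi|yj] : t y \in [set i; j] by rewrite -eq_t set22.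
    by exists (y, x); rewrite ?inE /= ?xS ?yS ?xj ?yi ?eqxx // /f setUC.
  by have := cards2 i j; rewrite -eq_t xj yj setUid cards1 nij.
case/setXP=> /setIdP[xS /eqP xi] /setIdP[yS /eqP yj]; rewrite /f /= in xS xi yS yj *.
rewrite imset_t xi yj eqxx andbT subUset !sub1set xS yS !andbT.
by apply/blowEP; exists x, y; rewrite xi yj -eq_d.
Qed.

(** Edges are grouped by their projection [d], and all edges over [d] have the same weight. *)
Lemma prod_blowE S (v : {set V} -> K) :
  \prod_(e in inducedE (blowE E n) S) (1 + v [set tag x | x in e]) =
  \prod_(d in E) (1 + v d) ^+ (\prod_(i in d) cnt t S i)%N.
Proof.
rewrite (partition_big (fun e : {set blowV n} => [set tag x | x in e]) (mem E)) /=; last first.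
  by move=> e; rewrite inE => /andP[/blowEP[x [y [-> xyE]]] _]; rewrite imset_t.
apply: eq_bigr => d dE.
rewrite (eq_bigr (fun=> 1 + v d)) => [|e /andP[_ /eqP-> //]].
rewrite -card_edges_over // -prodr_const; apply: eq_bigl => e.
by rewrite [RHS]inE.
Qed.

Lemma inducedE_clique S :
  inducedE (cliqueE n) S = \bigcup_i [set B : {set blowV n} | B \subset fibre t S i & #|B| == 2%N].
Proof.
apply/setP => e; rewrite [LHS]inE; apply/andP/bigcupP => [[/cliqueEP[x [y [-> xy nxy]]]]|].
  rewrite subUset !sub1set => /andP[xS yS]; exists (t x) => //.
  by rewrite inE subUset !sub1set cards2 nxy !inE xS yS xy !eqxx.
case=> i _; rewrite inE => /andP[eS /cards2P[x [y [nxy eq_e]]]].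
move: eS; rewrite eq_e !subUset !sub1set => /andP[/setIdP[xS /eqP xi] /setIdP[yS /eqP yi]].
split; last by rewrite xS.
by apply/cliqueEP; exists x, y; rewrite xi yi.
Qed.

(** The clique edges inside [S] are the 2-subsets of its fibres, and the fibre over [i] has
    $\binom{c_i}{2}$ of them for $c_i$ its size. *)
Lemma prod_cliqueE S (v : {set V} -> K) (w : V -> K) :
  \prod_(e in inducedE (cliqueE n) S) (1 + blowWt' E v w e) =
  \prod_(i : V) (1 + w i) ^+ ((cnt t S i * (cnt t S i - 1)) %/ 2)%N.
Proof.
rewrite inducedE_clique partition_disjoint_bigcup /=; last first.
  move=> i j nij; apply/pred0P => e /=; rewrite !inE; apply/negP.
  case/andP=> /andP[/subsetP eSi /eqP e2] /andP[/subsetP eSj _].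
  have /card_gt0P[x xe] : (0 < #|e|)%N by rewrite e2.
  have := eSi x xe; have := eSj x xe; rewrite !inE.
  by move=> /andP[_ /eqP->] /andP[_ /eqP ji]; rewrite ji eqxx in nij.
apply: eq_bigr => i _.
rewrite (eq_bigr (fun=> 1 + w i)) => [|e].
  by rewrite prodr_const cards_draws ffunE bin2 subn1 divn2.
rewrite inE => /andP[/subsetP eS /eqP e2].
have te z : z \in e -> tag z = i by move/eS; rewrite !inE => /andP[_ /eqP].
have img : [set tag z | z in e] = [set i].
  have /card_gt0P[x xe] : (0 < #|e|)%N by rewrite e2.
  apply/setP => j; rewrite inE; apply/imsetP/eqP => [[z ze ->]|->]; first exact: te.
  by exists x; rewrite ?te.
(* The projection is a singleton, hence not in [E], and the clique weight applies. Whichever end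
   point [pick] returns lies over [i]; the default 0 would require an empty edge. *)
rewrite /blowWt' ifF; last by apply/negP; rewrite img => /HE; rewrite cards1.
case: pickP => [x xe|e0]; first by rewrite /= te.
by have := eq_card0 e0; rewrite e2.
Qed.

(** A blow-up edge projects to two vertices, a clique edge to one. *)
Lemma disjoint_blow_clique S : [disjoint inducedE (blowE E n) S & inducedE (cliqueE n) S].
Proof.
apply/pred0P => e /=; rewrite ![_ \in inducedE _ _]inE; apply/negP.
case/andP=> /andP[/blowEP[x [y [-> xyE]]] _] /andP[/cliqueEP[a [b [eq_e ab _]]] _].
by have := HE xyE; rewrite -imset_t eq_e imset_t ab setUid cards1.
Qed.

Lemma prod_blow_cliqueE S (v : {set V} -> K) (w : V -> K) :
  \prod_(e in inducedE (blowE E n :|: cliqueE n) S) (1 + blowWt' E v w e) =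
  (\prod_(d in E) (1 + v d) ^+ (\prod_(i in d) cnt t S i)%N) *
  \prod_(i : V) (1 + w i) ^+ ((cnt t S i * (cnt t S i - 1)) %/ 2)%N.
Proof.
rewrite (eq_bigl [predU inducedE (blowE E n) S & inducedE (cliqueE n) S]); last first.
  by move=> e; rewrite !inE andb_orl.
rewrite bigU ?disjoint_blow_clique // prod_cliqueE -prod_blowE; congr (_ * _).
apply: eq_bigr => e; rewrite inE => /andP[/blowEP[x [y [-> xyE]]] _].
by rewrite /blowWt' imset_t xyE.
Qed.

Lemma blow_edge2 e : e \in blowE E n :|: cliqueE n -> exists x y, e = [set x; y].
Proof.
by rewrite inE => /orP[/blowEP|/cliqueEP] [x [y]] => [[-> _]|[-> _ _]]; exists x, y.
Qed.

End BlowUp.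

Theorem theorem3p3 (K : fieldType) (hK : [pchar K] =i pred0)
  (V : finType) (E : {set {set V}}) (HE : forall e, e \in E -> #|e| = 2%N)
  (q : K) (v : {set V} -> K) (w : V -> K) :
  (forall n : {ffun V -> nat},
     tutteZ (blowE E n) (@blowWt K V n v) q / (mfact n)%:R =
     spowr (fun m : {ffun V -> nat} =>
              (\prod_(e in E) (1 + v e) ^+ (\prod_(i in e) m i)%N)
              / (mfact m)%:R) q n) /\
  (forall n : {ffun V -> nat},
     tutteZ (blowE E n :|: cliqueE n) (@blowWt' K V E n v w) q / (mfact n)%:R =
     spowr (fun m : {ffun V -> nat} =>
              (\prod_(e in E) (1 + v e) ^+ (\prod_(i in e) m i)%N)
              * (\prod_(i : V) (1 + w i) ^+ ((m i * (m i - 1)) %/ 2)%N)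
              / (mfact m)%:R) q n).
Proof.
split=> n.
  have := @tutteZ_egf K V hK (blowV n) (fun x => tag x) (blowE E n) (@blowWt K V n v) _
    (fun m => \prod_(e in E) (1 + v e) ^+ (\prod_(i in e) m i)%N) _ q.
  (* The whole vertex set has fibre counts [n], so the general formula is read at the coefficient
     [n]. *)
  rewrite cnt_setT; apply=> [e eE|S]; last exact: prod_blowE.
  by apply: (@blow_edge2 _ E); rewrite inE eE.
have := @tutteZ_egf K V hK (blowV n) (fun x => tag x) (blowE E n :|: cliqueE n)
  (@blowWt' K V E n v w) _
  (fun m => (\prod_(e in E) (1 + v e) ^+ (\prod_(i in e) m i)%N) *
            (\prod_(i : V) (1 + w i) ^+ ((m i * (m i - 1)) %/ 2)%N)) _ q.
rewrite cnt_setT; apply=> [e|S]; first exact: blow_edge2.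
exact: prod_blow_cliqueE.
Qed.
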